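(* Let $(M,g)$ be a compact real analytic Riemannian surface, and let $\gamma_{x,\xi}$ be a periodic geodesic of period $L$. Suppose that $\{\varphi_{\lambda_j}\}$ is QER along $\gamma_{x,\xi}$. Then for all $\epsilon>0$ there exists $C_\epsilon>0$ so that $$\sum_{n\in\mathbb Z:\ |n|\ge(1-\epsilon)\lambda_j}|\nu_{\lambda_j}^{x,\xi}(n)|^2\ge C_\epsilon,$$ where $\nu_{\lambda_j}^{x,\xi}(n)=\frac1L\int_0^L\varphi_{\lambda_j}(\gamma_{x,\xi}(t))\,e^{-2\pi int/L}\,dt$ are the orbital Fourier coefficients of $\varphi_{\lambda_j}$ along $\gamma_{x,\xi}$.
   Context: $\Delta$ is the (nonnegative) Laplacian of $(M,g)$, and $\{\varphi_{\lambda_j}\}$ is a sequence of orthonormal eigenfunctions, $\Delta\varphi_{\lambda_j}=\lambda_j^2\varphi_{\lambda_j}$ (an orthonormal eigenbasis of $L^2(M)$ or a subsequence of one). For $(x,\xi)\in S^*M$, $\gamma_{x,\xi}:\mathbb R\to M$ is the arc-length parametrized geodesic with $\gamma_{x,\xi}(0)=x$, $\gamma_{x,\xi}'(0)=\xi$. QER (quantum ergodic restriction): $\{\varphi_{\lambda_j}\}$ is QER along $H=\gamma_{x,\xi}$ if its restrictions to $H$ are quantum ergodic, i.e. with $h_j=\lambda_j^{-1}$, for every semiclassical symbol $a\in S^{0,0}(T^*H\times[0,h_0))$ with principal term $a_0$, $$\lim_{j\to\infty}\langle Op_{h_j}(a)\varphi_{\lambda_j}|_H,\varphi_{\lambda_j}|_H\rangle_{L^2(H)}=\frac{4}{\mathrm{vol}(S^*M)}\int_{B^*H}a_0(s,\sigma)(1-|\sigma|^2)^{-1/2}\,ds\,d\sigma,$$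 where $B^*H$ is the unit co-ball bundle of $H$.
   Formalization: The bound is proved for all sufficiently large j; the range is |n| ≥ (L/2π)(1-ε)λ_j for every L, and the printed range |n| ≥ (1-ε)λ_j is asserted only for L ≥ 2π, since for L < 2π and small ε it contradicts QER. *)

(* Defs.v *)
From HB Require Import structures.
From mathcomp Require Import all_boot all_order all_algebra.
From mathcomp.real_closed Require Import complex.
From mathcomp Require Import all_classical all_reals all_analysis.

Set Implicit Arguments.
Unset Strict Implicit.
Unset Printing Implicit Defensive.

Import Order.TTheory GRing.Theory Num.Theory.
Import numFieldNormedType.Exports.

Local Open Scope classical_set_scope.
Local Open Scope ring_scope.

(* [Ck k U f]: the iterated directional derivatives of [f] of order at most [k],
   in all directions, exist and are continuous at every point of the set [U],
   which is meant to be open. *)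
Fixpoint Ck (R : realType) (V : normedModType R) (k : nat) (U : set V)
    (f : V -> R) : Prop :=
  (forall p, U p -> {for p, continuous f}) /\
  match k with
  | 0 => True
  | k'.+1 => forall v, (forall p, U p -> derivable f p v) /\ Ck k' U ('D_v f)
  end.

Definition smooth_on (R : realType) (V : normedModType R) (U : set V)
    (f : V -> R) : Prop :=
  forall k, Ck k U f.

(* Near each point of [U], [f] is the sum of an absolutely convergent double
   power series, grouped by total degree. Smoothness is then automatic; it is
   listed for convenience. *)
Definition analytic_on (R : realType) (U : set 'rV[R]_2) (f : 'rV[R]_2 -> R)
    : Prop :=
  smooth_on U f /\
  forall p, U p -> exists r : R, exists c : nat -> nat -> R,
    0 < r /\
    forall z : 'rV[R]_2, (forall k, `|z 0 k| < r) ->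
      cvgn (series (fun d =>
        \sum_(i < d.+1) `|c i (d - i)%N * z 0 0 ^+ i * z 0 1 ^+ (d - i)%N|)) /\
      series (fun d =>
        \sum_(i < d.+1) c i (d - i)%N * z 0 0 ^+ i * z 0 1 ^+ (d - i)%N) @ \oo
        --> f (p + z).

(* Partial derivative in the [a]-th coordinate of the plane. *)
Definition pd (R : realType) (a : 'I_2) (f : 'rV[R]_2 -> R) (y : 'rV[R]_2) : R :=
  'D_(delta_mx 0 a) f y.

(* A real analytic Riemannian structure on a boundaryless surface [M], given by
   an analytic atlas and the local expressions [metric i] of the metric tensor.
   Tangent vectors are row vectors, so the differential of a transition map is
   the right multiplication by the matrix [J] with [J a b] = d_a (component b). *)
Record analytic_surface (R : realType) (M : ptopologicalType) := AnalyticSurface {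
  chart_index : Type;
  dom : chart_index -> set M;
  chart : chart_index -> M -> 'rV[R]_2;
  chart_inv : chart_index -> 'rV[R]_2 -> M;
  metric : chart_index -> 'rV[R]_2 -> 'M[R]_2;
  dom_open : forall i, open (dom i);
  dom_cover : forall x, exists i, dom i x;
  img_open : forall i, open (chart i @` dom i);
  chart_invK : forall i x, dom i x -> chart_inv i (chart i x) = x;
  chart_continuous : forall i x, dom i x -> {for x, continuous (chart i)};
  chart_inv_continuous : forall i y, (chart i @` dom i) y ->
    {for y, continuous (chart_inv i)};
  transition_analytic : forall i j k,
    analytic_on (chart i @` (dom i `&` dom j))
      (fun y => chart j (chart_inv i y) 0 k);
  metric_analytic : forall i a b,
    analytic_on (chart i @` dom i) (fun y => metric i y a b);
  metric_sym : forall i y, (chart i @` dom i) y -> (metric i y)^T = metric i y;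
  metric_pos : forall i y, (chart i @` dom i) y -> forall v : 'rV[R]_2, v != 0 ->
    0 < (v *m metric i y *m v^T) 0 0;
  metric_transition : forall i j y, (chart i @` (dom i `&` dom j)) y ->
    let J := \matrix_(a, b) pd a (fun y => chart j (chart_inv i y) 0 b) y in
    metric i y = J *m metric j (chart j (chart_inv i y)) *m J^T
}.

Section Riemannian.
Context (R : realType) (M : ptopologicalType) (S : analytic_surface R M).

Definition christoffel (i : chart_index S) (y : 'rV[R]_2) (k a b : 'I_2) : R :=
  2^-1 * \sum_l invmx (metric i y) k l *
    (pd a (fun y => metric i y b l) y + pd b (fun y => metric i y a l) y
     - pd l (fun y => metric i y a b) y).

(* The nonnegative Laplacian of a function on the plane, in the chart [i]. *)
Definition laplacian (i : chart_index S) (F : 'rV[R]_2 -> R) (y : 'rV[R]_2) : R :=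
  let sqrtg y := Num.sqrt (\det (metric i y)) in
  - (sqrtg y)^-1 *
    \sum_a pd a (fun y => sqrtg y * \sum_b invmx (metric i y) a b * pd b F y) y.

(* A complete geodesic parametrized by arc length: in every chart, a smooth
   solution of the geodesic equation whose velocity has norm 1. *)
Definition unit_speed_geodesic (gamma : R -> M) : Prop :=
  continuous gamma /\
  forall i : chart_index S,
    let u k t := chart i (gamma t) 0 k in
    (forall k, smooth_on (gamma @^-1` dom i) (u k)) /\
    forall t, dom i (gamma t) ->
      (forall k, derive1n 2 (u k) t +
         \sum_a \sum_b christoffel i (chart i (gamma t)) k a b
           * derive1 (u a) t * derive1 (u b) t = 0) /\
      \sum_a \sum_b metric i (chart i (gamma t)) a b
        * derive1 (u a) t * derive1 (u b) t = 1.

End Riemannian.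

Definition borel (M : ptopologicalType) := g_sigma_algebraType (@open M).

Definition plane_point (R : realType) (p : R * R) : 'rV[R]_2 :=
  \row_k (if k == 0 then p.1 else p.2).

(* [mu] has the density [sqrt (det g)] in each chart; on a compact surface this
   determines [mu]. *)
Definition riemannian_volume (R : realType) (M : ptopologicalType)
    (S : analytic_surface R M) (mu : {measure set (borel M) -> \bar R}) : Prop :=
  forall (i : chart_index S) (A : set (borel M)), measurable A -> A `<=` dom i ->
    mu A = (\int[lebesgue_measure \x lebesgue_measure]_(p in
              [set p : R * R | (chart i @` A) (plane_point p)])
              (Num.sqrt (\det (metric i (plane_point p))))%:E)%E.

Definition Cint (d : measure_display) (T : measurableType d) (R : realType)
    (mu : {measure set T -> \bar R}) (D : set T) (f : T -> R[i]) : R[i] :=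
  Complex (\int[mu]_(x in D) complex.Re (f x)) (\int[mu]_(x in D) complex.Im (f x)).

Definition Ccvg (R : realType) (u : nat -> R[i]) (l : R[i]) : Prop :=
  (fun n => complex.Re (u n)) @ \oo --> complex.Re l /\ (fun n => complex.Im (u n)) @ \oo --> complex.Im l.

Definition Clim (R : realType) (u : nat -> R[i]) : R[i] :=
  Complex (lim ((fun n => complex.Re (u n)) @ \oo)) (lim ((fun n => complex.Im (u n)) @ \oo)).

Definition expi (R : realType) (t : R) : R[i] := Complex (cos t) (sin t).

(* Orthonormal eigenfunctions [phi j] with eigenvalues [lam j ^+ 2]. By the
   spectral theorem, the sequences of this kind are those which can be extracted
   from an orthonormal eigenbasis of L^2. *)
Definition orthonormal_eigenfunctions (R : realType) (M : ptopologicalType)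
    (S : analytic_surface R M) (mu : {measure set (borel M) -> \bar R})
    (phi : nat -> M -> R[i]) (lam : nat -> R) : Prop :=
  (forall j, 0 <= lam j) /\
  (forall j (i : chart_index S),
     let eigen F := smooth_on (chart i @` dom i) F /\
       forall y, (chart i @` dom i) y -> laplacian i F y = lam j ^+ 2 * F y in
     eigen (fun y => complex.Re (phi j (chart_inv i y))) /\
     eigen (fun y => complex.Im (phi j (chart_inv i y)))) /\
  (forall j k, Cint mu setT (fun x => phi j x * conjc (phi k x)) = (j == k)%:R).

(* The closed geodesic H of period L is treated as the circle R/LZ, by its arc
   length parametrization: functions on H are L-periodic functions on R, and the
   points (s, sigma) of T*H are pairs of reals, with L-periodicity in s. *)
Section Circle.
Context (R : realType) (L : R).

Definition partialT (a b : nat) (f : R * R -> R) : R * R -> R :=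
  let D (v : R * R) (g : R * R -> R) : R * R -> R := 'D_v g in
  iter a (D (1, 0)) (iter b (D (0, 1)) f).

Definition smooth_periodic (f : R * R -> R) : Prop :=
  smooth_on setT f /\ forall s sigma, f (s + L, sigma) = f (s, sigma).

(* Classical symbols: a(h) ~ sum_k h^k A_k for h in [0, h0), where A_k is a
   symbol of order -k on T*H and A_0 = a0. *)
Definition real_semiclassical_symbol (h0 : R) (a : R -> R * R -> R)
    (a0 : R * R -> R) : Prop :=
  (forall h, 0 <= h < h0 -> smooth_periodic (a h)) /\
  exists A : nat -> R * R -> R,
    A 0%N = a0 /\
    (forall k, smooth_periodic (A k)) /\
    (forall k al be, exists C : R, forall p,
       `|partialT al be (A k) p| <= C * (1 + `|p.2|) ^- (k + be)) /\
    (forall N al be, exists C : R, forall h p, 0 <= h < h0 ->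
       `|partialT al be (fun q => a h q - \sum_(k < N) h ^+ k * A k q) p|
         <= C * h ^+ N * (1 + `|p.2|) ^- (N + be)).

Definition semiclassical_symbol (h0 : R) (a : R -> R * R -> R[i])
    (a0 : R * R -> R[i]) : Prop :=
  real_semiclassical_symbol h0 (fun h p => complex.Re (a h p)) (fun p => complex.Re (a0 p)) /\
  real_semiclassical_symbol h0 (fun h p => complex.Im (a h p)) (fun p => complex.Im (a0 p)).

Definition fourier_coeff (u : R -> R[i]) (n : int) : R[i] :=
  (L^-1)%:C%C *
  Cint lebesgue_measure `[0, L] (fun t => u t * expi (- (2 * pi * n%:~R * t / L))).

(* The standard quantization
     (2 pi h)^-1 \int \int e^(i (s - s') sigma / h) a(s, sigma) u(s') ds' dsigma,
   as an oscillatory integral, maps e^(2 pi i n s / L) to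
   a(s, 2 pi n h / L) e^(2 pi i n s / L); it is therefore given by a Fourier
   series on L-periodic functions. *)
Definition Op (h : R) (a : R * R -> R[i]) (u : R -> R[i]) (s : R) : R[i] :=
  let term (n : int) := a (s, 2 * pi * n%:~R * h / L) * fourier_coeff u n
                          * expi (2 * pi * n%:~R * s / L) in
  Clim (fun N => term 0 + \sum_(1 <= k < N.+1) (term k%:Z + term (- k%:Z))).

Definition inner_H (u v : R -> R[i]) : R[i] :=
  Cint lebesgue_measure `[0, L] (fun s => u s * conjc (v s)).

(* Sum of |nu(n)|^2 over the integers n with T <= |n|. Since e^(2 pi i n t / L)
   has frequency 2 pi |n| / L, the condition "frequency at least (1 - eps) lambda"
   is the threshold T = L / (2 pi) * (1 - eps) lambda, which is
   (1 - eps) lambda when the length L is normalized to 2 pi. *)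
Definition tail_energy (u : R -> R[i]) (T : R) : \bar R :=
  let nu := fourier_coeff u in
  \esum_(n in [set n : int | T <= `|n%:~R : R|])
    (complex.Re (nu n) ^+ 2 + complex.Im (nu n) ^+ 2)%:E.

End Circle.

(* The fibres of S*M are unit circles, hence vol(S*M) = 2 pi vol(M). *)
Definition vol_cosphere (R : realType) (M : ptopologicalType)
    (mu : {measure set (borel M) -> \bar R}) : R :=
  2 * pi * fine (mu setT).

Definition QER (R : realType) (M : ptopologicalType)
    (mu : {measure set (borel M) -> \bar R}) (gamma : R -> M) (L : R)
    (phi : nat -> M -> R[i]) (lam : nat -> R) : Prop :=
  forall (h0 : R) (a : R -> R * R -> R[i]) (a0 : R * R -> R[i]),
    0 < h0 -> semiclassical_symbol L h0 a a0 ->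
    Ccvg
      (fun j => let h := (lam j)^-1 in
         inner_H L (Op L h (a h) (phi j \o gamma)) (phi j \o gamma))
      ((4 / vol_cosphere mu)%:C%C *
       Cint lebesgue_measure `[0, L] (fun s =>
         Cint lebesgue_measure `]-1, 1[ (fun sigma =>
           a0 (s, sigma) * ((Num.sqrt (1 - sigma ^+ 2))^-1)%:C%C))).

(* Main.v *)
(* Take e = min(eps, 1/2) and a smooth cutoff 0 <= f <= 1 supported in
   [1 - e, 1 - e/2], and apply QER to the symbol a(s, sigma) = f(sigma). As a
   depends on sigma only, Op_h(a) is a Fourier multiplier and
     <Op_h(a) u, u> = L sum_n f(2 pi n h / L) |nu(n)|^2,
   a finite sum which is at most L times the tail energy. The QER limit is
   (4 / vol S*M) L \int f(sigma) (1 - sigma^2)^(-1/2) dsigma, which is positive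
   because 0 < vol M < oo; keeping the support away from 1 makes the integrand
   bounded. *)
Require Import Defs.
From mathcomp Require Import all_boot all_order all_algebra.
From mathcomp.real_closed Require Import complex.
From mathcomp Require Import all_classical all_reals all_analysis zify ring lra.
Import Order.TTheory GRing.Theory Num.Theory.
Import numFieldNormedType.Exports.
Local Open Scope classical_set_scope.
Local Open Scope ring_scope.

Set Implicit Arguments.
Unset Strict Implicit.
Unset Printing Implicit Defensive.

(** * Smooth cutoffs as semiclassical symbols *)

(** The classical flat function e^(-1/x), together with the powers of 1/x that differentiation
    brings out of it. *)
Definition exp_inv_mono (R : realType) (n : nat) (x : R) : R :=
  if 0 < x then x^-1 ^+ n * expR (- x^-1) else 0.

(** With y = 1/x this is y^(n+1) / (n+1)! <= e^y, where the left side is one term of the exponential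
    series. The linear bound serves to prove continuity at 0. *)
Lemma exp_inv_mono_bound (R : realType) (n : nat) (x : R) :
  0 <= exp_inv_mono n x <= n.+1`!%:R * `|x|.
Proof.
rewrite /exp_inv_mono; case: ifPn => [x0|_]; last by rewrite lexx mulr_ge0.
have y0 : 0 < x^-1 by rewrite invr_gt0.
rewrite mulr_ge0 ?expR_ge0 ?(exprn_ge0 _ (ltW y0))//= expRN gtr0_norm//.
rewrite ler_pdivrMr ?expR_gt0// -ler_pdivrMl ?mulr_gt0 ?ltr0n ?fact_gt0//.
rewrite invfM -mulrA -exprS mulrC.
by apply: le_trans (expR_ge1Dxn n (ltW y0)); rewrite lerDr.
Qed.

Lemma is_derive_exp_inv_mono (R : realType) (n : nat) (x : R) :
  is_derive x 1 (exp_inv_mono n)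
    (exp_inv_mono n.+2 x - n%:R * exp_inv_mono n.+1 x).
Proof.
have [x0|x0|->] := ltgtP x 0.
- rewrite /exp_inv_mono !ltNge !(ltW x0)/= mulr0 subr0.
  apply: (@near_eq_is_derive _ _ _ (cst 0)) => /=.
  by near=> y; rewrite ltNge ltW//; near: y; exact: lt_nbhsl.
- apply: (@near_eq_is_derive _ _ _ ((fun y : R => y^-1) ^+ n *
    (expR \o (fun y : R => - y^-1)))).
    near=> y; rewrite /exp_inv_mono ifT ?fctE//.
    by near: y; exact: lt_nbhsr.
  have xN0 : x != 0 by rewrite gt_eqF.
  have dV : is_derive x 1 (fun y : R => y^-1) (- x ^- 2).
    have := @is_deriveV R id x 1 1 xN0 (is_derive_id x 1).
    by rewrite /GRing.scale/= mulr1.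
  have dN : is_derive x 1 (fun y : R => - y^-1) (x ^- 2).
    have := is_deriveN dV; rewrite opprK; exact.
  have dE := @is_derive1_comp R expR (fun y : R => - y^-1) x _ _
    (is_derive_expR _) dN.
  apply: is_derive_eq (is_deriveM (is_deriveX n dV) dE) _.
  rewrite /exp_inv_mono x0 /GRing.scale/= !fctE.
  case: n => [|n] /=; rewrite -!exprVn; [ring|rewrite !exprS; ring].
- have -> : exp_inv_mono n.+2 0 - n%:R * exp_inv_mono n.+1 0 = 0 :> R.
    by rewrite /exp_inv_mono ltxx mulr0 subr0.
  (* Writing f_n for [exp_inv_mono n], f_n(z) = z f_(n+1)(z), so the slope at 0 is f_(n+1)(z), which
     tends to 0 by the linear bound. *)
  apply/is_derive1_caratheodory; exists (exp_inv_mono n.+1); split.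
  + move=> z; rewrite /exp_inv_mono ltxx !subr0; case: ifPn => z0; last by rewrite mul0r.
    by rewrite exprS [RHS]mulrC !mulrA mulfV ?mul1r// gt_eqF.
  + rewrite /prop_for /continuous_at (_ : exp_inv_mono n.+1 0 = 0); last first.
      by rewrite /exp_inv_mono ltxx.
    apply: (@squeeze_cvgr _ _ _ _ (cst 0) (fun x : R => n.+2`!%:R * `|x|)).
    * by near=> z; exact: exp_inv_mono_bound.
    * exact: cvg_cst.
    * rewrite -[X in _ --> X](mulr0 (n.+2`!%:R)); apply: cvgMr.
      by rewrite -[X in _ --> X](normr0 R); apply: cvg_norm.
  + by rewrite /exp_inv_mono ltxx.
Unshelve. all: by end_near. Qed.

(* Since this class is stable under differentiation, its members are smooth and
   no formula for higher derivatives is needed. *)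
Inductive bump_algebra (R : realType) (al be : R) : (R -> R) -> Prop :=
| bump_left n : bump_algebra al be (fun x => exp_inv_mono n (x - al))
| bump_right n : bump_algebra al be (fun x => exp_inv_mono n (be - x))
| bump_scale c f : bump_algebra al be f -> bump_algebra al be (fun x => c * f x)
| bump_add f g : bump_algebra al be f -> bump_algebra al be g ->
    bump_algebra al be (fun x => f x + g x)
| bump_mul f g : bump_algebra al be f -> bump_algebra al be g ->
    bump_algebra al be (fun x => f x * g x).

Lemma bump_algebra_derive (R : realType) (al be : R) (f : R -> R) :
  bump_algebra al be f ->
  exists2 f', bump_algebra al be f' & forall x : R, is_derive x (1 : R) f (f' x).
Proof.
elim=> [n|n|c {}f _ [f' bf' df]|{}f g _ [f' bf' df] _ [g' bg' dg]
       |{}f g bf [f' bf' df] bg [g' bg' dg]].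
- exists (fun x => exp_inv_mono n.+2 (x - al) +
                   (- n%:R) * exp_inv_mono n.+1 (x - al)).
    by apply: bump_add; [exact: bump_left|apply: bump_scale; exact: bump_left].
  move=> x; have := @is_derive1_comp R (exp_inv_mono n) (shift (- al)) x _ _
    (is_derive_exp_inv_mono _ _) (is_derive_shift _ _ _).
  by rewrite mulr1 mulNr.
- exists (fun x => (-1) * (exp_inv_mono n.+2 (be - x) +
                   (- n%:R) * exp_inv_mono n.+1 (be - x))).
    apply: bump_scale.
    by apply: bump_add; [exact: bump_right|apply: bump_scale; exact: bump_right].
  move=> x; have := @is_derive1_comp R (exp_inv_mono n) (fun x => be - x) x _ _
    (is_derive_exp_inv_mono _ _)
    (is_deriveB (is_derive_cst be x (1 : R)) (is_derive_id x (1 : R))).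
  by rewrite sub0r mulrN1 mulN1r mulNr.
- exists (fun x => c * f' x); first exact: bump_scale.
  by move=> x; exact: is_deriveZ.
- exists (fun x => f' x + g' x); first exact: bump_add.
  by move=> x; exact: is_deriveD.
- exists (fun x => f x * g' x + g x * f' x).
    by apply: bump_add; exact: bump_mul.
  by move=> x; exact: is_deriveM.
Qed.

Lemma bump_algebra_continuous (R : realType) (al be : R) (f : R -> R) :
  bump_algebra al be f -> continuous f.
Proof.
move=> /bump_algebra_derive[f' _ df] x.
by apply: differentiable_continuous; apply/derivable1_diffP; case: (df x).
Qed.

(** [Ck] differentiates in all directions of the plane. For a function of sigma alone, the direction
    (v1, v2) acts as the direction v2 on the line, whence a derivative along an arbitrary real
    [v]. *)
Lemma bump_algebra_derivev (R : realType) (al be : R) (f : R -> R) :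
  bump_algebra al be f ->
  exists2 f', bump_algebra al be f' & forall v x : R, is_derive x v f (v * f' x).
Proof.
move=> /bump_algebra_derive[f' bf' df]; exists f' => // v x.
have [fx fx'] := df x.
have dfx : differentiable f x by exact/derivable1_diffP.
apply: DeriveDef; first exact: diff_derivable.
by rewrite deriveE// -[v in 'd f x v]mulr1 linearZ/= -deriveE// fx'.
Qed.

(** The algebra accounts for smoothness only: its generators vanish on one side of a point, so the
    compact support is a separate condition. *)
Definition test_function (R : realType) (al be : R) (f : R -> R) : Prop :=
  bump_algebra al be f /\ forall x, x \notin `[al, be] -> f x = 0.

Lemma test_function_scale (R : realType) (al be c : R) (f : R -> R) :
  test_function al be f -> test_function al be (fun x => c * f x).
Proof.
by case=> bf f0; split; [exact: bump_scale|move=> x /f0 ->; rewrite mulr0].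
Qed.

Lemma test_function_derive (R : realType) (al be : R) (f : R -> R) :
  test_function al be f ->
  exists2 f', test_function al be f' &
    forall v x : R, is_derive x v f (v * f' x).
Proof.
case=> /bump_algebra_derivev[f' bf' df] f0; exists f' => //; split=> // x xI.
have {}df := df 1 x.
have [_ <-] : is_derive x (1 : R) f 0.
  apply: (@near_eq_is_derive _ _ _ (cst 0)) => /=.
  (* The complement of the closed interval is open, so [f] vanishes in a neighbourhood of [x], which
     forces the derivative to be 0 there. *)
  have nI : nbhs x (~` [set` `[al, be]]).
    by apply: open_nbhs_nbhs; split; [apply: closed_openC; exact: interval_closed|exact/negP].
  by near=> y; rewrite f0//; apply/negP; near: y.
by have [_] := df; rewrite mul1r => ->.
Unshelve. all: by end_near. Qed.

Lemma test_function_bounded (R : realType) (al be : R) (f : R -> R) (m : nat) :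
  al <= be -> test_function al be f ->
  exists C, forall x, `|f x| <= C * (1 + `|x|) ^- m.
Proof.
move=> ab [bf f0].
have cf : {within `[al, be], continuous (fun x => `|f x|)}.
  apply: continuous_subspaceT => x; apply: cvg_norm.
  exact: bump_algebra_continuous bf x.
have [c cI cmax] := EVT_max ab cf.
(* [B] bounds |x| on the support, so the maximum of |f| times (1 + B)^m absorbs the weight for any
   [m]. *)
pose B := Num.max `|al| `|be|.
exists (`|f c| * (1 + B) ^+ m) => x.
have x1 : 0 < 1 + `|x| by rewrite ltr_wpDr.
rewrite ler_pdivlMr ?exprn_gt0//.
have [xI|/f0 ->] := boolP (x \in `[al, be]); last first.
  by rewrite normr0 mul0r mulr_ge0// exprn_ge0// addr_ge0// /B le_max normr_ge0.
apply: ler_pM => //; [exact: cmax|].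
apply: lerXn2r; rewrite ?nnegrE; [exact: ltW|by rewrite addr_ge0// /B le_max normr_ge0|].
rewrite lerD2l /B; move: xI; rewrite in_itv/= => /andP[ax xb].
have [x0|x0] := leP 0 x; rewrite le_max.
  by rewrite ger0_norm// (le_trans xb (ler_norm _)) orbT.
by rewrite ltr0_norm// -normrN (le_trans _ (ler_norm _))// lerN2.
Qed.


Lemma test_function_Ck (R : realType) (al be : R) (k : nat) (f : R -> R) :
  test_function al be f -> Ck k setT (fun p : R * R => f p.2).
Proof.
elim: k f => [|k IH] f tf; split=> //.
- move=> p _; apply: continuous_comp; first exact: cvg_snd.
  exact: bump_algebra_continuous tf.1 _.
- move=> p _; apply: continuous_comp; first exact: cvg_snd.
  exact: bump_algebra_continuous tf.1 _.
- move=> v; have [f' tf' df] := test_function_derive tf.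
  (* By computation, the difference quotient of p |-> f p.2 along [v] is that of [f] at [p.2] along
     [v.2], so the one-variable derivative applies as it stands. *)
  split=> [p _|]; first by case: (df v.2 p.2).
  have -> : 'D_v (fun p : R * R => f p.2) = fun p => v.2 * f' p.2.
    by apply/funext => p; case: (df v.2 p.2) => _ <-.
  exact: IH (test_function_scale v.2 tf').
Qed.

Lemma test_function_partialT (R : realType) (al be : R) (a b : nat) (f : R -> R) :
  test_function al be f ->
  exists2 g, test_function al be g &
    partialT a b (fun p : R * R => f p.2) = fun p => g p.2.
Proof.
have step (v : R * R) g : test_function al be g ->
    exists2 g', test_function al be g' &
      'D_v (fun p : R * R => g p.2) = fun p => g' p.2.
  move=> tg; have [g' tg' dg] := test_function_derive tg.
  exists (fun x => v.2 * g' x); first exact: test_function_scale.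
  by apply/funext => p; case: (dg v.2 p.2) => _ <-.
move=> tf; rewrite /partialT.
have [g tg ->] : exists2 g, test_function al be g &
    iter b (fun g : R * R -> R => 'D_((0, 1) : R * R) g : R * R -> R)
      (fun p : R * R => f p.2) = fun p => g p.2.
  elim: b => [|b [g tg IH]]; first by exists f.
  by rewrite iterS IH; exact: step.
elim: a => [|a [h th IH]]; first by exists g.
by rewrite iterS IH; exact: step.
Qed.

Lemma partialT0 (R : realType) (a b : nat) :
  partialT a b (fun=> 0 : R) = fun=> 0.
Proof.
have step (v : R * R) : 'D_v (fun=> 0 : R) = fun=> 0.
  by apply/funext => p; rewrite derive_cst.
rewrite /partialT; elim: a => [|a IH]; last by rewrite iterS IH.
by elim: b => [//|b IH]; rewrite /= in IH *; rewrite IH.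
Qed.

Lemma test_function_symbol (R : realType) (L h0 al be : R) (f : R -> R) :
  al <= be -> test_function al be f ->
  real_semiclassical_symbol L h0 (fun _ p => f p.2) (fun p => f p.2).
Proof.
move=> ab tf.
have per g : test_function al be g -> smooth_periodic L (fun p => g p.2).
  by move=> tg; split=> [k|s sigma]; [exact: test_function_Ck tg|by []].
have bnd g a b m : test_function al be g -> exists C, forall p : R * R,
    `|partialT a b (fun p : R * R => g p.2) p| <= C * (1 + `|p.2|) ^- m.
  move=> tg; have [g' tg' ->] := test_function_partialT a b tg.
  by have [C HC] := test_function_bounded m ab tg'; exists C => p; exact: HC.
split=> [h _|]; first exact: per.
(* The expansion stops after A_0 = f. The other terms are written 0 * f so that they are test
   functions too. The remainder is [f] itself for N = 0 and vanishes for N >= 1. *)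
exists (fun k p => if k is 0 then f p.2 else 0 * f p.2); split=> //; split; [|split].
- by case=> [|k]; [exact: per|exact: per (test_function_scale 0 tf)].
- by case=> [|k] a b; [exact: bnd|exact: bnd (test_function_scale 0 tf)].
- case=> [|N] a b.
    have [C HC] := bnd f a b (0 + b)%N tf; exists C => h p _.
    rewrite expr0 mulr1; apply: le_trans (HC p).
    by under eq_fun do rewrite big_ord0 subr0.
  exists 0 => h p _; rewrite !mul0r (_ : (fun q => _) = fun=> 0) ?partialT0 ?normr0//.
  apply/funext => q; rewrite big_ord_recl/= expr0 mul1r big1 ?addr0 ?subrr// => i _.
  by rewrite mul0r mulr0.
Qed.

Lemma test_function_complex_symbol (R : realType) (L h0 al be : R) (f : R -> R) :
  al <= be -> test_function al be f ->
  semiclassical_symbol L h0 (fun _ p => (f p.2)%:C%C) (fun p => (f p.2)%:C%C).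
Proof.
move=> ab tf; split; first exact: test_function_symbol ab tf.
(* The zero imaginary part is a symbol as the test function 0 * f. *)
have t0 := test_function_symbol L h0 ab (test_function_scale 0 tf).
by have <- : (fun p : R * R => 0 * f p.2) = (fun=> 0)
  by apply/funext => p; rewrite mul0r.
Qed.

Lemma exists_test_function (R : realType) (al be : R) :
  exists f : R -> R, [/\ test_function al be f, forall x, 0 <= f x,
    forall x, f x <= 1 & forall x, al < x < be -> 0 < f x].
Proof.
(* For n = 0 there is no power of 1/x, so each factor is at most 1. *)
exists (fun x => exp_inv_mono 0 (x - al) * exp_inv_mono 0 (be - x)); split.
- split; first by apply: bump_mul; [exact: bump_left|exact: bump_right].
  move=> x; rewrite in_itv/= negb_and -!ltNge /exp_inv_mono !subr_gt0 => /orP[xa|xb].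
    by rewrite ltNge (ltW xa)/= mul0r.
  by rewrite [x < be]ltNge (ltW xb)/= mulr0.
- move=> x; apply: mulr_ge0.
    by have /andP[] := exp_inv_mono_bound 0 (x - al).
  by have /andP[] := exp_inv_mono_bound 0 (be - x).
- move=> x; have le1 (y : R) : 0 <= exp_inv_mono 0 y <= 1.
    have /andP[-> _] /= := exp_inv_mono_bound 0 y.
    rewrite /exp_inv_mono; case: ifPn => // y0.
    by rewrite expr0 mul1r expR_le1 oppr_le0 invr_ge0 ltW.
  by have /andP[? ?] := le1 (x - al); have /andP[? ?] := le1 (be - x);
    rewrite mulr_ile1.
- move=> x /andP[ax xb]; rewrite /exp_inv_mono !subr_gt0 ax xb !expr0 !mul1r.
  by rewrite mulr_gt0 ?expR_gt0.
Qed.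

(** * The volume of the surface *)

Lemma det_mx22 (R : comNzRingType) (A : 'M[R]_2) :
  \det A = A 0 0 * A 1 1 - A 0 1 * A 1 0.
Proof.
rewrite (expand_det_row _ 0) !big_ord_recl big_ord0 /cofactor !det_mx11 !mxE.
have -> : lift 0 0 = 1 :> 'I_2 by exact/val_inj.
have -> : lift 1 0 = 0 :> 'I_2 by exact/val_inj.
by rewrite expr0 expr1 mul1r mulN1r mulrN addr0.
Qed.

(** The integral of a nonnegative function is the supremum over the simple functions below it, hence
    monotone for arbitrary functions. This serves to bound the density sqrt(det g) by a constant. *)
Lemma ge0_le_integral_nonmeasurable d (T : measurableType d) (R : realType)
    (mu : {measure set T -> \bar R}) (D : set T) (f g : T -> \bar R) :
  (forall x, D x -> 0 <= f x)%E -> (forall x, D x -> f x <= g x)%E ->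
  (\int[mu]_(x in D) f x <= \int[mu]_(x in D) g x)%E.
Proof.
move=> f0 fg.
have g0 x : D x -> (0 <= g x)%E by move=> Dx; exact: le_trans (f0 x Dx) (fg x Dx).
rewrite !ge0_integralE//; apply: le_ereal_sup => _ [h hf <-]; exists h => // x.
by apply: le_trans (hf x) _; apply: lee_restrict.
Qed.

(** By continuity, sqrt(det g) stays below its value at the point plus 1 on a small coordinate ball,
    whose Lebesgue measure is finite. *)
Lemma chart_ball_volume_finite (R : realType) (M : ptopologicalType)
    (S : analytic_surface R M) (mu : {measure set (borel M) -> \bar R}) (x : M) :
  riemannian_volume S mu ->
  exists A : set M, [/\ open A, A x & (mu (A : set (borel M)) < +oo)%E].
Proof.
move=> vol; have [i dx] := dom_cover S x.
pose U : set 'rV[R]_2 := chart i @` dom i.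
pose sg y := Num.sqrt (\det (metric i y)) : R.
have Ux : U (chart i x) by exists x.
have cm a b : {for chart i x, continuous (fun y => metric i y a b)}.
  by have [/(_ 0%N)[+ _] _] := metric_analytic i a b; apply.
have csg : {for chart i x, continuous sg}.
  apply: continuous_comp; last exact: sqrt_continuous.
  have -> : (fun y => \det (metric i y)) =
      (fun y => metric i y 0 0 * metric i y 1 1 - metric i y 0 1 * metric i y 1 0).
    by apply/funext => y; exact: det_mx22.
  by apply: continuousB; apply: continuousM; exact: cm.
have : \forall y \near chart i x, U y /\ sg y < sg (chart i x) + 1.
  near=> y; split; near: y.
    by apply: open_nbhs_nbhs; split => //; exact: img_open.
  by apply: cvgr_lt csg _ _; rewrite ltrDl.
move=> /nbhs_ballP[r /= r0 rU].
pose A : set M := dom i `&` chart i @^-1` ball (chart i x) r.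
have oA : open A.
  rewrite openE => z [dz bz]; apply: filterI.
    by apply: open_nbhs_nbhs; split=> //; exact: dom_open.
  apply: (chart_continuous dz); apply: open_nbhs_nbhs; split => //.
  exact: ball_open.
exists A; split=> //; first by split=> //; exact: ballxx.
rewrite (vol i A); last by move=> z [].
  (* Balls of ['rV[R]_2] are those of the sup norm, so the coordinate ball is the square [D]. It
     lies in the image of the chart, hence [A] corresponds to all of [D]. *)
  pose D := ball (chart i x 0 0) r `*` ball (chart i x 0 1) r.
  pose K := sg (chart i x) + 1.
  have DE : [set p | (chart i @` A) (plane_point p)] `<=` D.
    move=> p [z [_ [_ bz]] zp]; split.
      by have := bz 0 0; rewrite zp mxE.
    by have := bz 0 1; rewrite zp mxE.
  have DA p : D p -> ball (chart i x) r (plane_point p).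
    move=> [p1 p2]; split=> // a b; rewrite ord1 mxE; case: ifPn => [/eqP->//|b0].
    by have -> : b = 1 by apply/val_inj; case: b b0 => [[|[|]]].
  have -> : [set p | (chart i @` A) (plane_point p)] = D.
    apply/seteqP; split=> // p Dp; have [] := rU _ (DA p Dp).
    by move=> [z dz zp] _; exists z => //; split=> //=; rewrite zp; exact: DA.
  apply: (@le_lt_trans _ _ (\int[lebesgue_measure \x lebesgue_measure]_(p in D) K%:E)%E).
    apply: ge0_le_integral_nonmeasurable => p Dp; rewrite lee_fin ?sqrtr_ge0//.
    by have [_ /ltW] := rU _ (DA p Dp).
  have mB (a : R) : measurable (ball a r : set (measurableTypeR R)).
    by rewrite ball_itv; exact: measurable_itv.
  rewrite integral_cst; last exact: measurableX.
  have bE (a : R) : lebesgue_measure (ball a r) = (r *+ 2)%:E.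
    exact: lebesgue_measure_ball (ltW r0).
  rewrite [X in (_ * X)%E]product_measure1E; [|exact: mB..].
  by rewrite [X in (_ * (X * _))%E]bE [X in (_ * (_ * X))%E]bE -!EFinM ltry.
by apply: sub_sigma_algebra.
Unshelve. all: by end_near. Qed.

(** Compactness extracts a finite cover by open sets of finite volume, and subadditivity
    concludes. *)
Lemma compact_volume_finite (R : realType) (M : ptopologicalType)
    (S : analytic_surface R M) (mu : {measure set (borel M) -> \bar R}) :
  compact [set: M] -> riemannian_volume S mu -> (mu [set: borel M] < +oo)%E.
Proof.
move=> cM vol.
have [A HA] := choice (fun x => chart_ball_volume_finite x vol).
move: cM; rewrite compact_cover => /(_ M setT A)[|x _|D _ DT].
- by move=> x _; have [] := HA x.
- by exists x => //; have [] := HA x.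
have mA x : measurable (A x : set (borel M)).
  by apply: sub_sigma_algebra; have [] := HA x.
have -> : [set: borel M] = \big[setU/set0]_(x <- finmap.enum_fset D) (A x : set (borel M)).
  by rewrite -bigcup_fset; apply/seteqP; split.
(* Measurability is carried through the induction because subadditivity asks for it. *)
suff [] : measurable (\big[setU/set0]_(x <- finmap.enum_fset D) (A x : set (borel M))) /\
   (mu (\big[setU/set0]_(x <- finmap.enum_fset D) (A x : set (borel M))) < +oo)%E by [].
apply: (big_ind (fun B : set (borel M) => measurable B /\ (mu B < +oo)%E)).
- by rewrite measure0 ltry.
- move=> B C [mB B1] [mC C1]; split; first exact: measurableU.
  by apply: le_lt_trans (measureU2 mu mB mC) _; rewrite lte_add_pinfty.
- by move=> x _; split=> //; have [] := HA x.
Qed.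

(** For a null measure every integral vanishes, whereas [phi 0] has norm 1. *)
Lemma orthonormal_volume_neq0 (R : realType) (M : ptopologicalType)
    (S : analytic_surface R M) (mu : {measure set (borel M) -> \bar R})
    (phi : nat -> M -> R[i]) (lam : nat -> R) :
  orthonormal_eigenfunctions S mu phi lam -> mu [set: borel M] != 0%E.
Proof.
case=> _ [_ orth]; apply/eqP => mu0; have := orth 0%N 0%N.
have int0 (f : borel M -> \bar R) : (\int[mu]_x f x = 0)%E.
  rewrite (eq_measure_integral mzero) ?integral_measure_zero// => A mA _.
  have muA : (mu A <= 0)%E by rewrite -mu0 le_measure// inE.
  by apply/eqP; rewrite eq_le muA measure_ge0.
rewrite /Cint /Rintegral !int0 eqxx => -[] /eqP.
by rewrite eq_sym oner_eq0.
Qed.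

(** Finiteness of the volume matters for positivity as well, since [fine] sends +oo to 0. *)
Lemma vol_cosphere_gt0 (R : realType) (M : ptopologicalType)
    (S : analytic_surface R M) (mu : {measure set (borel M) -> \bar R})
    (phi : nat -> M -> R[i]) (lam : nat -> R) :
  compact [set: M] -> riemannian_volume S mu ->
  orthonormal_eigenfunctions S mu phi lam -> 0 < vol_cosphere mu.
Proof.
move=> cM vol orth; rewrite /vol_cosphere !mulr_gt0 ?pi_gt0//.
rewrite fine_gt0// (compact_volume_finite cM vol) andbT lt0e measure_ge0 andbT.
exact: orthonormal_volume_neq0 orth.
Qed.

(** Near each point [f] is its local expression composed with the chart. This yields the continuity
    of the eigenfunctions on [M]. *)
Lemma continuous_in_charts (R : realType) (M : ptopologicalType)
    (S : analytic_surface R M) (f : M -> R) :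
  (forall i, smooth_on (chart i @` @dom _ _ S i) (fun y => f (chart_inv i y))) ->
  continuous f.
Proof.
move=> sf x; have [i dx] := dom_cover S x.
have cf : {for chart i x, continuous (fun y => f (chart_inv i y))}.
  by have [+ _] := sf i 0%N; apply; exists x.
have cfc := continuous_comp (chart_continuous dx) cf.
have fE : f x = ((fun y => f (chart_inv i y)) \o chart i) x.
  by rewrite /= chart_invK.
rewrite /continuous_at fE; apply: cvg_trans cfc.
apply: near_eq_cvg; near=> z; rewrite /= chart_invK//; near: z.
by apply: open_nbhs_nbhs; split=> //; exact: dom_open.
Unshelve. all: by end_near. Qed.

(** * Fourier multipliers on the circle *)

(** The range -N..N, listed so that each step adds the pair of terms [N], [-N] that [Op] groups
    together. Being free of repetitions, the list can be compared with a sum over a set of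
    integers. *)
Fixpoint symmetric_ints (N : nat) : seq int :=
  if N is N'.+1 then N%:Z :: - N%:Z :: symmetric_ints N' else [:: 0].

Lemma mem_symmetric_ints N (n : int) : n \in symmetric_ints N -> (`|n| <= N)%N.
Proof.
elim: N => [|N IH] /=; first by rewrite inE => /eqP ->.
by rewrite !inE => /or3P[/eqP->|/eqP->|/IH]; lia.
Qed.

Lemma symmetric_ints_uniq N : uniq (symmetric_ints N).
Proof.
elim: N => [//|N IH] /=; rewrite IH andbT inE negb_or.
by apply/andP; split; [apply/andP; split|];
  do ?[apply/negP => /mem_symmetric_ints]; lia.
Qed.

Lemma big_symmetric_ints (V : nmodType) (F : int -> V) N :
  F 0 + \sum_(1 <= k < N.+1) (F k%:Z + F (- k%:Z)) =
  \sum_(n <- symmetric_ints N) F n.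
Proof.
elim: N => [|N IH]; first by rewrite big_geq// addr0 big_seq1.
by rewrite big_nat_recr//= !big_cons -IH addrA [LHS]addrC -addrA.
Qed.

Lemma Clim_eventually_cst (R : realType) (u : nat -> R[i]) (c : R[i]) :
  (\forall N \near \oo, u N = c) -> Clim u = c.
Proof.
move=> uc; case: c uc => cr ci uc; rewrite /Clim; congr Complex;
  apply: (lim_near_cst (@norm_hausdorff _ _));
  by apply: filterS uc => N ->.
Qed.

(** * Integrals of continuous complex-valued functions *)

Lemma Re_addc (R : rcfType) (x y : R[i]) :
  complex.Re (x + y) = complex.Re x + complex.Re y.
Proof. by case: x y => [? ?] [? ?]. Qed.

Lemma Im_addc (R : rcfType) (x y : R[i]) :
  complex.Im (x + y) = complex.Im x + complex.Im y.
Proof. by case: x y => [? ?] [? ?]. Qed.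

Lemma Re_mulc (R : rcfType) (x y : R[i]) : complex.Re (x * y) =
  complex.Re x * complex.Re y - complex.Im x * complex.Im y.
Proof. by case: x y => [? ?] [? ?]. Qed.

Lemma Im_mulc (R : rcfType) (x y : R[i]) : complex.Im (x * y) =
  complex.Re x * complex.Im y + complex.Im x * complex.Re y.
Proof. by case: x y => [? ?] [? ?]. Qed.

Lemma Re_conjc (R : rcfType) (x : R[i]) : complex.Re (conjc x) = complex.Re x.
Proof. by case: x. Qed.

Lemma Im_conjc (R : rcfType) (x : R[i]) : complex.Im (conjc x) = - complex.Im x.
Proof. by case: x. Qed.

(** Continuity is stated componentwise because [Cint] integrates the real and imaginary parts
    separately. *)
Definition continuous_RI (R : realType) (u : R -> R[i]) : Prop :=
  continuous (fun t => complex.Re (u t)) /\ continuous (fun t => complex.Im (u t)).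

Section ContinuousComplexIntegral.
Context (R : realType).
Implicit Types u v : R -> R[i].

Lemma continuous_RI_cst c : continuous_RI (fun _ : R => c).
Proof. by split=> t; exact: cvg_cst. Qed.

Lemma continuous_RI_add u v : continuous_RI u -> continuous_RI v ->
  continuous_RI (fun t => u t + v t).
Proof.
move=> [ur ui] [vr vi]; split=> t.
- by under eq_fun do rewrite Re_addc; apply: cvgD; [exact: ur|exact: vr].
- by under eq_fun do rewrite Im_addc; apply: cvgD; [exact: ui|exact: vi].
Qed.

Lemma continuous_RI_mul u v : continuous_RI u -> continuous_RI v ->
  continuous_RI (fun t => u t * v t).
Proof.
move=> [ur ui] [vr vi]; split=> t.
- under eq_fun do rewrite Re_mulc.
  by apply: cvgB; apply: cvgM; [exact: ur|exact: vr|exact: ui|exact: vi].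
- under eq_fun do rewrite Im_mulc.
  by apply: cvgD; apply: cvgM; [exact: ur|exact: vi|exact: ui|exact: vr].
Qed.

Lemma continuous_RI_conj u : continuous_RI u ->
  continuous_RI (fun t => conjc (u t)).
Proof.
move=> [ur ui]; split=> t.
- by under eq_fun do rewrite Re_conjc; exact: ur.
- by under eq_fun do rewrite Im_conjc; apply: cvgN; exact: ui.
Qed.

Lemma continuous_RI_expi (c : R) : continuous_RI (fun t => expi (c * t)).
Proof.
have cc : continuous (fun t : R => c * t) by exact: mulrl_continuous.
split=> t.
- by apply: (continuous_comp (cc t)); exact: continuous_cos.
- by apply: (continuous_comp (cc t)); exact: continuous_sin.
Qed.

Context (a b : R).
Local Notation I := (Cint lebesgue_measure `[a, b]).

Lemma continuous_itvcc_integrable (f : R -> R) : continuous f ->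
  lebesgue_measure.-integrable `[a, b] (EFin \o f).
Proof.
move=> cf; apply: continuous_compact_integrable; first exact: segment_compact.
exact: continuous_subspaceT.
Qed.

Lemma Cint_add u v : continuous_RI u -> continuous_RI v ->
  I (fun t => u t + v t) = I u + I v.
Proof.
move=> [ur ui] [vr vi]; rewrite /Cint; apply/eqP; rewrite eq_complex /=.
apply/andP; split; apply/eqP.
- under eq_Rintegral do rewrite Re_addc.
  by rewrite RintegralD//; exact: continuous_itvcc_integrable.
- under eq_Rintegral do rewrite Im_addc.
  by rewrite RintegralD//; exact: continuous_itvcc_integrable.
Qed.

Lemma Cint_scale c u : continuous_RI u -> I (fun t => c * u t) = c * I u.
Proof.
move=> [ur ui]; rewrite /Cint; apply/eqP; rewrite eq_complex Re_mulc Im_mulc /=.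
have cZ (k : R) (f : R -> R) : continuous f -> continuous (fun t => k * f t).
  by move=> cf t; apply: cvgMr; exact: cf.
have iZ (k : R) (f : R -> R) : continuous f ->
    lebesgue_measure.-integrable `[a, b] (EFin \o (fun t => k * f t)).
  by move=> cf; apply: continuous_itvcc_integrable; exact: cZ.
apply/andP; split; apply/eqP.
- under eq_Rintegral do rewrite Re_mulc.
  rewrite RintegralB//; [|exact: iZ..].
  by rewrite !RintegralZl//; exact: continuous_itvcc_integrable.
- under eq_Rintegral do rewrite Im_mulc.
  rewrite RintegralD//; [|exact: iZ..].
  by rewrite !RintegralZl//; exact: continuous_itvcc_integrable.
Qed.

Lemma Cint_conj u : continuous_RI u -> I (fun t => conjc (u t)) = conjc (I u).
Proof.
move=> [ur ui]; rewrite /Cint /=; apply/eqP; rewrite eq_complex /=.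
apply/andP; split; apply/eqP; first by apply: eq_Rintegral => t _; rewrite Re_conjc.
rewrite -[RHS]mulN1r -RintegralZl//; last exact: continuous_itvcc_integrable.
by apply: eq_Rintegral => t _; rewrite Im_conjc mulN1r.
Qed.

Lemma continuous_RI_sum (J : Type) (r : seq J) (F : J -> R -> R[i]) :
  (forall j, continuous_RI (F j)) -> continuous_RI (fun t => \sum_(j <- r) F j t).
Proof.
move=> cF; elim: r => [|j r IH].
  by under eq_fun do rewrite big_nil; exact: continuous_RI_cst.
by under eq_fun do rewrite big_cons; exact: continuous_RI_add.
Qed.

Lemma Cint_sum (J : Type) (r : seq J) (F : J -> R -> R[i]) :
  (forall j, continuous_RI (F j)) ->
  I (fun t => \sum_(j <- r) F j t) = \sum_(j <- r) I (F j).
Proof.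
move=> cF; elim: r => [|j r IH].
  (* The empty sum is written 0 * 0 so that [Cint_scale] evaluates its integral. *)
  have -> : (fun t => \sum_(j <- [::]) F j t) = (fun=> 0 * 0).
    by apply/funext => t; rewrite big_nil mul0r.
  by rewrite big_nil Cint_scale ?mul0r//; exact: continuous_RI_cst.
have -> : (fun t => \sum_(i <- j :: r) F i t) =
    (fun t => F j t + \sum_(i <- r) F i t).
  by apply/funext => t; rewrite big_cons.
by rewrite big_cons -IH Cint_add//; exact: continuous_RI_sum.
Qed.

End ContinuousComplexIntegral.

Section FourierMultiplier.
Context (R : realType) (L : R) (L0 : 0 < L) (u : R -> R[i]) (cu : continuous_RI u).
Context (f : R -> R) (h : R).
Local Notation nu := (fourier_coeff L u).
Local Notation freq n := (2 * pi * n%:~R * h / L).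

Lemma expiN (t : R) : expi (- t) = conjc (expi t).
Proof. by rewrite /expi cosN sinN. Qed.

Lemma continuous_RI_character (n : int) :
  continuous_RI (fun t => expi (2 * pi * n%:~R * t / L)).
Proof.
have -> : (fun t => expi (2 * pi * n%:~R * t / L)) =
    (fun t => expi ((2 * pi * n%:~R / L) * t)).
  by apply/funext => t; rewrite mulrAC.
exact: continuous_RI_expi.
Qed.

(** The symbol vanishes at every frequency beyond [N], so the partial sums defining [Op] are
    constant from [N] on, and so is their limit. *)
Lemma Op_multiplier N : (forall k, (N < k)%N -> f (freq k%:Z) = 0) ->
  (forall k, (N < k)%N -> f (freq (- k%:Z)) = 0) ->
  Op L h (fun p => (f p.2)%:C%C) u =
  fun s => \sum_(n <- symmetric_ints N)
    (f (freq n))%:C%C * nu n * expi (2 * pi * n%:~R * s / L).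
Proof.
move=> f0 f0N; apply/funext => s; apply: Clim_eventually_cst.
exists N => // K /= NK.
pose F n := (f (freq n))%:C%C * nu n * expi (2 * pi * n%:~R * s / L).
rewrite -/(F _) -(big_symmetric_ints F); congr (_ + _).
rewrite (big_cat_nat _ (n := N.+1))//= [X in _ + X]big_nat_cond.
rewrite [X in _ + X]big1 ?addr0// => k /andP[/andP[Nk _] _].
by rewrite /F /= f0// f0N// !mul0r addr0.
Qed.

Lemma inner_H_Op_multiplier N : (forall k, (N < k)%N -> f (freq k%:Z) = 0) ->
  (forall k, (N < k)%N -> f (freq (- k%:Z)) = 0) ->
  complex.Re (inner_H L (Op L h (fun p => (f p.2)%:C%C) u) u) =
  L * \sum_(n <- symmetric_ints N)
    f (freq n) * (complex.Re (nu n) ^+ 2 + complex.Im (nu n) ^+ 2).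
Proof.
move=> f0 f0N; rewrite (Op_multiplier f0 f0N).
pose F n s := (f (freq n))%:C%C * nu n *
  (expi (2 * pi * n%:~R * s / L) * conjc (u s)).
have ceu n : continuous_RI (fun s => expi (2 * pi * n%:~R * s / L) * conjc (u s)).
  apply: continuous_RI_mul; last exact: continuous_RI_conj.
  exact: continuous_RI_character.
transitivity (complex.Re (Cint lebesgue_measure `[0, L]
    (fun s => \sum_(n <- symmetric_ints N) F n s))).
  congr (complex.Re (Cint _ _ _)); apply/funext => s.
  by rewrite mulr_suml; apply: eq_bigr => n _; rewrite /F mulrA.
rewrite Cint_sum; last first.
  by move=> n; apply: continuous_RI_mul => //; exact: continuous_RI_cst.
rewrite (big_morph _ (@Re_addc R) (erefl : complex.Re (0 : R[i]) = 0)) mulr_sumr.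
apply: eq_bigr => n _; rewrite Cint_scale//.
(* The pairing of the n-th character with [u] is L times the conjugate of nu(n), so each term
   becomes L f |nu(n)|^2. *)
have -> : Cint lebesgue_measure `[0, L]
    (fun t => expi (2 * pi * n%:~R * t / L) * conjc (u t)) =
    conjc (L%:C%C * nu n).
  have LV : L%:C%C * (L^-1)%:C%C = 1 by rewrite -rmorphM mulfV ?gt_eqF.
  rewrite /fourier_coeff mulrA LV mul1r -Cint_conj.
    congr (Cint _ _ _); apply/funext => t.
    rewrite expiN; apply/eqP; rewrite eq_complex !(Re_mulc, Im_mulc, Re_conjc, Im_conjc).
    by apply/andP; split; apply/eqP; ring.
  apply: continuous_RI_mul => //.
  under eq_fun do rewrite expiN.
  by apply: continuous_RI_conj; exact: continuous_RI_character.
by rewrite !(Re_mulc, Im_mulc, Re_conjc, Im_conjc); move: (nu n) => z /=; ring.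
Qed.

(** Only integers with |n| >= T carry a nonzero weight, and the weights are at most 1. What remains
    is a finite partial sum of the tail. *)
Lemma inner_H_le_tail_energy N (T : R) :
  (forall k, (N < k)%N -> f (freq k%:Z) = 0) ->
  (forall k, (N < k)%N -> f (freq (- k%:Z)) = 0) ->
  (forall s, 0 <= f s <= 1) ->
  (forall n : int, f (freq n) != 0 -> T <= `|n%:~R|) ->
  ((complex.Re (inner_H L (Op L h (fun p => (f p.2)%:C%C) u) u) / L)%:E
    <= tail_energy L u T)%E.
Proof.
move=> f0 f0N f01 fT; rewrite (inner_H_Op_multiplier f0 f0N) mulrAC mulfV ?gt_eqF//.
rewrite mul1r; pose r := [seq n <- symmetric_ints N | T <= `|n%:~R| :> R].
have ur : uniq r by rewrite filter_uniq// symmetric_ints_uniq.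
apply: esum_ge; exists [set` r].
  split; first exact: finite_seq.
  by move=> n /=; rewrite mem_filter => /andP[].
rewrite -fsbig_seq// sumEFin lee_fin big_filter [leRHS]big_mkcond/=.
apply: ler_sum => n _; have /andP[fn0 fn1] := f01 (freq n).
have E0 : 0 <= complex.Re (nu n) ^+ 2 + complex.Im (nu n) ^+ 2.
  by rewrite addr_ge0 ?sqr_ge0.
case: ifPn => [_|nT]; first by rewrite ler_piMl.
have [->|/fT Tn] := eqVneq (f (freq n)) 0; first by rewrite mul0r.
by rewrite Tn in nT.
Qed.

End FourierMultiplier.

(** * The limit and the lower bound *)

(** The weight is singular only at -1 and 1, so the integrand [G] is continuous on the support
    [al, be]. The integral is then at least the minimum of [G] on a smaller interval times its
    length. *)
Lemma arcsine_integral_gt0 (R : realType) (al be : R) (f : R -> R) :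
  -1 < al -> al < be -> be < 1 -> test_function al be f ->
  (forall x, 0 <= f x) -> (forall x, al < x < be -> 0 < f x) ->
  0 < \int[lebesgue_measure]_(x in `]-1, 1[) (f x * (Num.sqrt (1 - x ^+ 2))^-1).
Proof.
move=> al1 ab be1 [bf f_out] f0 fpos.
pose G (x : R) := f x * (Num.sqrt (1 - x ^+ 2))^-1.
have G0 x : 0 <= G x by rewrite mulr_ge0// invr_ge0 sqrtr_ge0.
have sub1 x : x \in `[al, be] -> 0 < Num.sqrt (1 - x ^+ 2).
  rewrite in_itv/= => /andP[ax xb].
  have -> : 1 - x ^+ 2 = (1 - x) * (1 + x) by ring.
  by rewrite sqrtr_gt0 mulr_gt0//; lra.
have -> : \int[lebesgue_measure]_(x in `]-1, 1[) G x =
    \int[lebesgue_measure]_(x in `[al, be]) G x.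
  have -> : [set` `[al, be]] = [set` `]-1, 1[] `&` [set` `[al, be]].
    apply/esym/setIidPr => x /=; rewrite !in_itv/= => /andP[ax xb].
    by rewrite (lt_le_trans al1 ax) (le_lt_trans xb be1).
  rewrite Rintegral_mkcondr; apply: eq_Rintegral => x _; rewrite patchE.
  case: ifPn => //; rewrite notin_setE/= => /negP xI.
  by rewrite /G f_out// mul0r.
have cG : {within `[al, be], continuous G}.
  apply: continuous_in_subspaceT => x; rewrite inE/= => /sub1 sx.
  apply: cvgM; first exact: bump_algebra_continuous bf x.
  apply: cvgV; first by rewrite gt_eqF.
  apply: (@continuous_comp _ _ _ (fun x : R => 1 - x ^+ 2)); last exact: sqrt_continuous.
  by apply: cvgB; [exact: cvg_cst|exact: exprn_continuous].
have iG : lebesgue_measure.-integrable `[al, be] (EFin \o G).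
  by apply: continuous_compact_integrable => //; exact: segment_compact.
(* [f] vanishes at [al] and [be], so the minimum is taken over the middle third [J], where it is
   positive. *)
pose d := (be - al) / 3; have d0 : 0 < d by rewrite divr_gt0// subr_gt0.
pose J := `[al + d, be - d].
have JI : [set` J] `<=` [set` `[al, be]].
  by move=> x /=; rewrite !in_itv/= /d => /andP[? ?]; apply/andP; split; lra.
have [c cJ cmin] : exists2 c, c \in J & forall x, x \in J -> G c <= G x.
  by apply: EVT_min; [rewrite /d; lra|exact: continuous_subspaceW cG].
have Gc : 0 < G c.
  apply: mulr_gt0; last by rewrite invr_gt0 sub1//; exact: JI.
  by apply: fpos; move: cJ; rewrite in_itv/= /d => /andP[? ?]; apply/andP; split; lra.
have iJ : lebesgue_measure.-integrable [set` J] (EFin \o G).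
  apply: (@integrableS _ _ _ lebesgue_measure `[al, be]) => //.
have mJ : lebesgue_measure [set` J] = (be - d - (al + d))%:E.
  by rewrite lebesgue_measure_itv/= lte_fin ifT// /d; lra.
have low : G c * (be - d - (al + d)) <= \int[lebesgue_measure]_(x in `[al, be]) G x.
  rewrite -lee_fin /Rintegral fineK; last exact: integrable_fin_num.
  apply: (@le_trans _ _ (\int[lebesgue_measure]_(x in [set` J]) (G x)%:E)%E).
    rewrite EFinM -mJ -integral_cst//.
    apply: ge0_le_integral => //; first by move=> x _; rewrite lee_fin ltW.
    exact: measurable_int iJ.
  apply: ge0_subset_integral => //; first exact: measurable_int iG.
  by move=> x _; rewrite lee_fin.
by apply: lt_le_trans low; rewrite mulr_gt0// /d; lra.
Qed.

(** The inner integral does not depend on s, so integration over the circle multiplies it by the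
    length L. The form [(s, sigma).2] is the one that [QER] yields for the symbol
    [fun p => f p.2]. *)
Lemma QER_limit (R : realType) (L : R) (f : R -> R) : 0 < L ->
  Cint lebesgue_measure `[0, L] (fun s =>
    Cint lebesgue_measure `]-1, 1[ (fun sigma =>
      (f (s, sigma).2)%:C%C * ((Num.sqrt (1 - sigma ^+ 2))^-1)%:C%C)) =
  (L * \int[lebesgue_measure]_(x in `]-1, 1[)
         (f x * (Num.sqrt (1 - x ^+ 2))^-1))%:C%C.
Proof.
move=> L0; set I := \int[_]_(_ in _) _.
have inner (s : R) : Cint lebesgue_measure `]-1, 1[ (fun sigma =>
    (f (s, sigma).2)%:C%C * ((Num.sqrt (1 - sigma ^+ 2))^-1)%:C%C) = I%:C%C.
  congr Complex; first
    by apply: eq_Rintegral => x _; rewrite Re_mulc /= mulr0 subr0.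
  rewrite (@eq_Rintegral _ _ _ _ _ (cst 0)); last first.
    by move=> x _; rewrite Im_mulc /= mulr0 mul0r addr0.
  by rewrite Rintegral_cst// mul0r.
transitivity (Cint lebesgue_measure `[0, L] (fun=> I%:C%C)).
  by congr (Cint _ _ _); apply/funext => s; exact: inner.
rewrite /Cint /= !Rintegral_cst//= lebesgue_measure_itv/= lte_fin L0 oppr0 addr0/=.
by rewrite !mul0r mulrC.
Qed.

Lemma cutoff_eventually0 (R : realType) (L h be : R) (f : R -> R) :
  0 < L -> 0 <= h -> (forall x, x <= 0 -> f x = 0) ->
  (forall x, be < x -> f x = 0) ->
  exists N, forall k, (N < k)%N ->
    f (2 * pi * k%:Z%:~R * h / L) = 0 /\ f (2 * pi * (- k%:Z)%:~R * h / L) = 0.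
Proof.
move=> L0 h0 fneg fbe.
have pi0 := pi_gt0 R.
(* For h > 0, the frequency 2 pi k h / L exceeds |be| as soon as k > |be| L / (2 pi h). The
   frequencies of the negative integers are at most 0, where [f] vanishes. *)
exists (Num.truncn (`|be| * L / (2 * pi * h))) => k Nk; split; last first.
  apply: fneg; rewrite rmorphN/= mulrN !mulNr oppr_le0 divr_ge0 ?(ltW L0)//.
  by rewrite !mulr_ge0// ltW.
(* The value h = 0 arises as the inverse of a zero eigenvalue parameter; all frequencies are then 0,
   and f 0 = 0. *)
have [->|hN0] := eqVneq h 0; first by rewrite mulr0 mul0r fneg.
have hp : 0 < h by rewrite lt_neqAle eq_sym hN0.
apply: fbe; apply: (le_lt_trans (ler_norm _)); rewrite ltr_pdivlMr//.
have : `|be| * L / (2 * pi * h) < k%:R.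
  by apply: lt_le_trans (truncnS_gt _) _; rewrite ler_nat.
by rewrite ltr_pdivrMr ?mulr_gt0// -pmulrn; lra.
Qed.

Lemma frequency_threshold (R : realType) (L lam al : R) (n : int) :
  0 < L -> 0 <= lam -> 0 < al -> al <= 2 * pi * n%:~R * lam^-1 / L ->
  L / (2 * pi) * (al * lam) <= `|n%:~R|.
Proof.
move=> L0 lam0 al0 H; have pi0 := pi_gt0 R.
have [lamE|lamN0] := eqVneq lam 0; first by rewrite lamE !mulr0.
have lamp : 0 < lam by rewrite lt_neqAle eq_sym lamN0.
apply: le_trans (ler_norm _).
rewrite mulrAC ler_pdivrMr ?mulr_gt0//.
move: H; rewrite ler_pdivlMr// ler_pdivlMr//; lra.
Qed.

Lemma le_tail_energy (R : realType) (L T1 T2 : R) (u : R -> R[i]) :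
  T1 <= T2 -> (tail_energy L u T2 <= tail_energy L u T1)%E.
Proof.
move=> T12; apply: le_ereal_sup => _ [X [fX XT] <-]; exists X => //.
by split=> // n /XT /=; exact: le_trans.
Qed.

Theorem lemma3 (R : realType) (M : ptopologicalType)
    (S : analytic_surface R M) (mu : {measure set (borel M) -> \bar R})
    (gamma : R -> M) (L : R) (phi : nat -> M -> R[i]) (lam : nat -> R) :
  hausdorff_space M -> compact [set: M] ->
  riemannian_volume S mu ->
  unit_speed_geodesic S gamma ->
  0 < L -> (forall t, gamma (t + L) = gamma t) ->
  orthonormal_eigenfunctions S mu phi lam ->
  QER mu gamma L phi lam ->
  forall eps : R, 0 < eps ->
  exists C : R, 0 < C /\
    \forall j \near \oo,
      (C%:E <= tail_energy L (phi j \o gamma)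
                 (L / (2 * pi) * ((1 - eps) * lam j)))%E /\
      (2 * pi <= L ->
        (C%:E <= tail_energy L (phi j \o gamma) ((1 - eps) * lam j))%E).
Proof.
move=> _ cM vol [cgamma _] L0 _ orth qer eps eps0.
have vol0 := vol_cosphere_gt0 cM vol orth.
case: orth => [lam0 [eigen _]].
have pi0 := pi_gt0 R.
(* [eps] may exceed 1. The cap 1/2 keeps [al] positive, so [f] lives on positive frequencies. *)
pose e := Num.min eps 2^-1.
have e0 : 0 < e by rewrite lt_min eps0 invr_gt0 ltr0n.
have ele : e <= eps by rewrite ge_min lexx.
have e2 : e <= 2^-1 by rewrite ge_min lexx orbT.
pose al := 1 - e; pose be := 1 - e / 2.
have al0 : 0 < al by rewrite /al; lra.
have albe : al < be by rewrite /al /be; lra.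
have be1 : be < 1 by rewrite /be; lra.
have [f [tf f0 f1 fpos]] := exists_test_function al be.
have f_le x : x <= 0 -> f x = 0.
  by move=> x0; apply: tf.2; rewrite in_itv/= negb_and -ltNge (le_lt_trans x0).
have f_gt x : be < x -> f x = 0.
  by move=> bx; apply: tf.2; rewrite in_itv/= negb_and orbC -ltNge bx.
have f_ne x : f x != 0 -> al <= x.
  by apply: contraNT; rewrite -ltNge => xa; rewrite tf.2// in_itv/= negb_and -ltNge xa.
(* Continuity along the geodesic is the regularity required by the integrals over H. *)
have cu j : continuous_RI (phi j \o gamma).
  have cRe : continuous (fun x => complex.Re (phi j x)).
    by apply: (continuous_in_charts (S := S)) => i; have [[]] := eigen j i.
  have cIm : continuous (fun x => complex.Im (phi j x)).
    by apply: (continuous_in_charts (S := S)) => i; have [_ []] := eigen j i.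
  by split=> t; [exact: continuous_comp (cgamma t) (cRe _)|
                 exact: continuous_comp (cgamma t) (cIm _)].
have := qer 1 _ _ ltr01 (test_function_complex_symbol L 1 (ltW albe) tf).
rewrite QER_limit// => -[+ _].
set I := \int[_]_(_ in _) _.
have I0 : 0 < I by apply: (arcsine_integral_gt0 _ albe be1 tf) => //; lra.
set u := (fun n : nat => complex.Re _) => cvu.
have l0 : 0 < 4 / vol_cosphere mu * (L * I).
  by rewrite !mulr_gt0 ?invr_gt0.
(* Half of the limit, which [u j] eventually exceeds. Dividing by [L] accounts for the factor L
   between the quadratic form and the Fourier energy. *)
pose l := 4 / vol_cosphere mu * (L * I) / 2.
have l_gt0 : 0 < l by rewrite divr_gt0.
exists (l / L); split; first by rewrite divr_gt0.
have ul : \forall j \near \oo, l <= u j.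
  apply: (cvgr_ge _ cvu); rewrite Re_mulc /= mul0r subr0 /l; lra.
near=> j.
have h0 : 0 <= (lam j)^-1 by rewrite invr_ge0.
have [N HN] := cutoff_eventually0 L0 h0 f_le f_gt.
have main : ((l / L)%:E <= tail_energy L (phi j \o gamma)
                 (L / (2 * pi) * (al * lam j)))%E.
  apply: (@le_trans _ _ (u j / L)%:E).
    by rewrite lee_fin ler_pdivrMr// divfK ?gt_eqF//; near: j.
  apply: (inner_H_le_tail_energy L0 (cu j) (N := N)).
  - by move=> k /HN[].
  - by move=> k /HN[].
  - by move=> s; rewrite f0 f1.
  - by move=> n /f_ne; exact: frequency_threshold.
(* Since e <= eps, the requested threshold is no larger than the one coming from the cutoff, and
   lowering a threshold only increases the tail. *)
have T1 : (1 - eps) * lam j <= al * lam j.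
  by rewrite ler_wpM2r// /al lerB.
split=> [|piL].
  apply: le_trans main (le_tail_energy _ _ _).
  by rewrite ler_wpM2l// divr_ge0 ?mulr_ge0 ?ltW.
(* When L >= 2 pi the factor L / (2 pi) is at least 1, so the unscaled threshold is again the
   smaller one, as al * lam j >= 0. *)
apply: le_trans main (le_tail_energy _ _ _).
apply: le_trans T1 _; rewrite ler_peMl ?mulr_ge0 ?(ltW al0)//.
by rewrite ler_pdivlMr ?mulr_gt0// mul1r.
Unshelve. all: by end_near. Qed.
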